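(* Let $n \ge 5$ be an integer with $n \equiv 3$ or $5 \pmod 6$. If $n \notin \{9, 11\}$, then there exists a $2$-regular graph $G$ with $n$ vertices and girth at least $5$ for which there is a design. If $n \in \{9, 11\}$, then there is no $2$-regular graph with $n$ vertices and girth at least $5$ for which there is a design.
   Context: All graphs are finite and simple (undirected, no loops, no multiple edges) and need not be connected. A graph is $\delta$-regular if every vertex has exactly $\delta$ neighbours. The girth of a graph is the length of a shortest cycle in it. For a vertex $i$, $N(i)$ is the set of neighbours of $i$ and $N[i] = \{i\} \cup N(i)$ is its closed neighbourhood. Let $\delta \ge 2$ and let $G$ be a $\delta$-regular graph with vertex set $V$, $|V| = n$, and girth at least $5$. A design for $G$ (a design of order $n$) is a collection $\mathcal{B}$ of subsets of $V$, called blocks, such that: (i) each block has exactly $\delta + 1$ elements; (ii) each point of $V$ lies in the same number of blocks; (iii) each pair of distinct points of $V$ that is not an edge of $G$ is contained in exactly one block; (iv) each pair of points of $V$ that is an edge of $G$ is contained in exactly two blocks; and (v) every closed neighbourhood $N[i]$, $i \in V$, is a block. (That is, a regular-graph design with $\lambda = 1$ and block size $\delta+1$ in which all the duplicated pairs come from the neighbourhood blocks $N[i]$.) *)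

(* Defs.v *)
From HB Require Import structures.
From mathcomp Require Import all_boot.

Set Implicit Arguments.
Unset Strict Implicit.
Unset Printing Implicit Defensive.

Record sgraph (V : finType) := SGraph {
  adj :> rel V;
  adj_sym : symmetric adj;
  adj_irrefl : irreflexive adj
}.

Definition nbhd (V : finType) (G : sgraph V) (x : V) : {set V} :=
  [set y | G x y].

Definition closed_nbhd (V : finType) (G : sgraph V) (x : V) : {set V} :=
  x |: nbhd G x.

Definition regular (V : finType) (G : sgraph V) (delta : nat) : Prop :=
  forall x : V, #|nbhd G x| = delta.

(* [cycle] and [ucycle] of path.v also accept sequences of size at most 2
   (the empty sequence, and an edge traversed back and forth), which are not
   graph cycles. *)
Definition graph_cycle (V : finType) (G : sgraph V) (c : seq V) : bool :=
  (3 <= size c) && ucycleb G c.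

(* Relational, so that an acyclic graph has no girth in nat. *)
Definition is_girth (V : finType) (G : sgraph V) (g : nat) : Prop :=
  (exists2 c : seq V, graph_cycle G c & size c = g) /\
  (forall c : seq V, graph_cycle G c -> g <= size c).

Definition girth_at_least (V : finType) (G : sgraph V) (k : nat) : Prop :=
  exists2 g : nat, is_girth G g & k <= g.

(* Taking the blocks as a set rather than a multiset loses nothing when
   delta >= 2 and the girth is at least 5: all pairs in a repeated block would
   be covered twice, hence be edges, so the block would contain a triangle. *)
Definition is_design (V : finType) (G : sgraph V) (delta : nat)
    (B : {set {set V}}) : Prop :=
  [/\ forall b : {set V}, b \in B -> #|b| = delta.+1,
      exists r : nat, forall x : V, #|[set b in B | x \in b]| = r,
      forall x y : V, x != y -> ~~ G x y ->
        #|[set b in B | (x \in b) && (y \in b)]| = 1,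
      forall x y : V, G x y ->
        #|[set b in B | (x \in b) && (y \in b)]| = 2
    & forall x : V, closed_nbhd G x \in B].

(* Main.v *)
Require Import Defs.
From HB Require Import structures.
From mathcomp Require Import all_boot all_algebra.
From mathcomp Require Import zify.

Set Implicit Arguments.
Unset Strict Implicit.
Unset Printing Implicit Defensive.

Import GRing.Theory.

(** A 2-regular graph of girth at least 5 is a disjoint union of cycles of
    length at least 5.  Its closed neighbourhoods already cover the edges twice
    and the pairs with a common neighbour once, so a design is the same as a
    decomposition into triangles of the graph of all the other pairs, called
    here far pairs; every vertex lies in #|V| - 5 of them.

    If at most n(n-5)/6 triples cover all far pairs, then each far pair is
    covered once and no other pair at all, by counting pairs
    ([exact_cover_of_count]); that all points lie in equally many blocks follows
    by counting the pairs through a point ([replication_number]).  So for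
    existence it is enough to exhibit a small
    cover, and difference methods do it.

    If n = 5 (mod 6), let Z/n be the vertex set and join x to x + e.  The far
    pairs are those whose difference is, up to sign, neither e nor 2e; if the
    remaining differences in {1, ..., (n-1)/2} are split into triples (a, b, c)
    with a + b = c or a + b + c = n, the translates of {0, a, a + b} form the
    decomposition.  If n = 3 (mod 6), the number of remaining differences is
    not right for this, and the vertex set is Z/N with N = n - 5, plus five
    points at infinity that form a 5-cycle.  Now two odd differences and the
    difference N/2 are set aside: an odd difference splits, by the parity of x,
    into two perfect matchings {x, x + o}, the difference N/2 is one perfect
    matching, and joining each of these five matchings to its own point at
    infinity covers the pairs that contain one such point.

    The differences are split by nesting: the even numbers 2j are the
    differences of c - j and c + j, the odd numbers 2j + 1 those of c - j and
    c + j + 1.  Two nests with adjacent spans use up almost everything, and the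
    step e is chosen so that the few numbers left over are e, 2e and those set
    aside.  This gives one family for each class of n modulo 12
    ([design_12p_5], [design_12p_23], [design_12p_15], [design_12p_21]), whose
    smallest members leave out exactly the orders 9 and 11.

    For these two orders the possible graphs are a 9-cycle, an 11-cycle, and
    graphs with a 5-cycle as a component.  On the 9-cycle 0, ..., 8 no vertex is
    far from both 0 and 4.  On the 11-cycle, the blocks {i, i+5, i+8} and then
    {i, i+4, i+7} are forced for all i, and {0, 4, 7} and {7, 0, 3} share the
    pair {0, 7}.  Beside a 5-cycle, a vertex y has only one vertex z outside the
    5-cycle that is far from it, so every vertex x of the 5-cycle needs the
    block {x, y, z}. *)

(** * Counting pairs in a family of blocks *)

Definition pair_count (V : finType) (U : {set {set V}}) (x y : V) : nat :=
  #|[set b in U | (x \in b) && (y \in b)]|.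

Lemma sum_pointwise_eq (I : finType) (P : pred I) (f g : I -> nat) :
    (forall i, P i -> f i <= g i) ->
    \sum_(i | P i) g i <= \sum_(i | P i) f i ->
  forall i, P i -> f i = g i.
Proof.
move=> le_fg le_sum i Pi; apply/eqP; rewrite eqn_leq le_fg //=.
move: le_sum; rewrite (bigD1 i) //= [X in _ <= X](bigD1 i) //=.
have : \sum_(j | P j && (j != i)) f j <= \sum_(j | P j && (j != i)) g j.
  by apply: leq_sum => j /andP[Pj _]; apply: le_fg.
by lia.
Qed.

Lemma pair_count_sum_point (V : finType) (U : {set {set V}}) (x : V) :
  \sum_(y | y != x) pair_count U x y = \sum_(b in U | x \in b) #|b|.-1.
Proof.
transitivity (\sum_(b in U) \sum_(y | y != x) ((x \in b) && (y \in b))).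
  rewrite exchange_big; apply: eq_bigr => y _.
  rewrite /pair_count -sum1_card big_mkcond /= [RHS]big_mkcond /=.
  by apply: eq_bigr => b _; rewrite inE; case: (b \in U).
rewrite big_mkcondr; apply: eq_bigr => b _; case: ifP => xb /=; last first.
  by rewrite big1.
rewrite (cardsD1 x b) xb /= -sum1_card big_mkcond [RHS]big_mkcond.
by apply: eq_bigr => y _; rewrite !inE; case: (y == x); case: (y \in b).
Qed.

Lemma pair_count_sum (V : finType) (U : {set {set V}}) :
  \sum_(p : V * V | p.2 != p.1) pair_count U p.1 p.2
    = \sum_(b in U) #|b| * #|b|.-1.
Proof.
rewrite -(pair_big_dep xpredT (fun x y => y != x) (pair_count U)) /=.
under eq_bigr do rewrite pair_count_sum_point.
rewrite (exchange_big_dep (mem U)) /=; last by move=> x b _ /andP[].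
apply: eq_bigr => b bU; rewrite -sum_nat_const.
by apply: eq_bigl => x; rewrite bU.
Qed.

(** Summed over all pairs, the coverage is at most #|U| k (k-1), which by
    assumption does not exceed the sum of the lower bound R; hence both
    estimates are equalities term by term. *)
Lemma exact_cover_of_count (V : finType) (U : {set {set V}}) (R : rel V)
    (k : nat) :
    1 < k -> irreflexive R ->
    (forall b, b \in U -> #|b| <= k) ->
    (forall x y, R x y -> exists2 b, b \in U & (x \in b) && (y \in b)) ->
    #|U| * (k * k.-1) <= #|[set p : V * V | R p.1 p.2]| ->
  (forall b, b \in U -> #|b| = k) /\
  (forall x y, x != y -> pair_count U x y = R x y).
Proof.
move=> k_gt1 irrR szU covU leU.
have le_pt (p : V * V) : p.2 != p.1 -> R p.1 p.2 <= pair_count U p.1 p.2.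
  move=> _; case Rp: (R _ _) => //=; have [b bU pb] := covU _ _ Rp.
  by apply/card_gt0P; exists b; rewrite inE bU.
have cardR : #|[set p : V * V | R p.1 p.2]|
    = \sum_(p : V * V | p.2 != p.1) R p.1 p.2.
  rewrite -sum1_card big_mkcond [RHS]big_mkcond /=; apply: eq_bigr => -[x y] _.
  by rewrite inE /=; case: eqP => [->|_]; rewrite ?irrR //=; case: (R _ _).
have le_b b : b \in U -> #|b| * #|b|.-1 <= k * k.-1.
  by move=> /szU le_bk; rewrite leq_mul // -!subn1 leq_sub2r.
have le_sum : \sum_(b in U) #|b| * #|b|.-1 <= #|U| * (k * k.-1).
  by rewrite -sum_nat_const; apply: leq_sum.
have ge_sum : #|[set p : V * V | R p.1 p.2]| <= \sum_(b in U) #|b| * #|b|.-1.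
  by rewrite cardR -pair_count_sum; apply: leq_sum.
split=> [b bU|x y neq_xy].
  have eq_b : #|b| * #|b|.-1 = k * k.-1.
    apply: (sum_pointwise_eq le_b) (bU); rewrite sum_nat_const.
    exact: leq_trans leU _.
  have := szU b bU; rewrite leq_eqVlt => /predU1P[//|lt_bk].
  suff : #|b| * #|b|.-1 < k * k.-1 by rewrite eq_b ltnn.
  case: k lt_bk k_gt1 {szU leU le_b le_sum eq_b} => // k.
  by rewrite ltnS => le_bk k_gt0; nia.
have := @sum_pointwise_eq _ _ _ _ le_pt _ (x, y).
rewrite pair_count_sum -cardR /=.
by move=> -> //; [exact: leq_trans leU | rewrite eq_sym].
Qed.

(** Both sides count the pairs (y, b) with x and y distinct points of the
    block b. *)
Lemma replication_number (V : finType) (G : sgraph V) (delta k : nat)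
    (B : {set {set V}}) (x : V) :
    #|nbhd G x| = delta ->
    (forall b, b \in B -> #|b| = k.+1) ->
    (forall y, x != y -> ~~ G x y -> pair_count B x y = 1) ->
    (forall y, G x y -> pair_count B x y = 2) ->
  #|[set b in B | x \in b]| * k = #|V|.-1 + delta.
Proof.
move=> degx szB nonadj adj.
transitivity (\sum_(b in B | x \in b) #|b|.-1).
  rewrite -sum_nat_const; apply: eq_big => [b|b]; first by rewrite inE.
  by rewrite inE => /andP[/szB ->].
rewrite -pair_count_sum_point -degx.
transitivity (\sum_(y | y != x) (1 + G x y)).
  apply: eq_bigr => y neq_yx; case Gxy: (G x y); first by rewrite adj.
  by rewrite nonadj ?Gxy // eq_sym.
rewrite big_split /= sum1_card cardC1; congr (_ + _).
rewrite -sum1_card big_mkcond [RHS]big_mkcond; apply: eq_bigr => y _.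
rewrite inE; case: eqP => [->|_]; first by rewrite adj_irrefl.
by case: (G x y).
Qed.

(** * The 2-regular graph of a successor function *)

Definition design_of_order (n : nat) : Prop :=
  exists (V : finType) (G : sgraph V),
    [/\ #|V| = n, regular G 2, girth_at_least G 5
      & exists B : {set {set V}}, is_design G 2 B].

Lemma girth_exists (V : finType) (G : sgraph V) (k : nat) (c : seq V) :
  graph_cycle G c -> (forall c', graph_cycle G c' -> k <= size c') ->
  girth_at_least G k.
Proof.
move=> cyc_c ge_k; pose P m := [exists t : m.-tuple V, graph_cycle G t].
have exP : exists m, P m by exists (size c); apply/existsP; exists (in_tuple c).
have [m /existsP[t cyc_t] min_m] := ex_minnP exP.
exists m; last by rewrite -(size_tuple t) ge_k.
split; first by exists t => //; apply: size_tuple.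
by move=> c' cyc_c'; apply: min_m; apply/existsP; exists (in_tuple c').
Qed.

(** Every 2-regular graph of girth at least 5 arises from a bijection without
    cycles of length less than 5, by orienting its components.  In this form
    the vertices near a given vertex are its images under few iterates, all
    distinct. *)
Section Successor.

Variables (V : finType) (s : V -> V).
Hypothesis s_inj : injective s.
Hypothesis s_order : forall x k, 0 < k < 5 -> iter k s x != x.

Definition far (x y : V) : bool :=
  ~~ [|| x == y, s x == y, s y == x, s (s x) == y | s (s y) == x].

Lemma iter_neq x :
  [/\ (s x == x) = false, (s (s x) == x) = false,
      (s (s (s x)) == x) = false & (s (s (s (s x))) == x) = false].
Proof.
by split; apply/negbTE;
  [apply: (s_order x (k := 1)) | apply: (s_order x (k := 2))
  | apply: (s_order x (k := 3)) | apply: (s_order x (k := 4))].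
Qed.

(* Together with injectivity, these decide every equation between iterates of
   one point whose exponents differ by at most 4. *)
Let s1 x : (s x == x) = false. Proof. by case: (iter_neq x). Qed.
Let s2 x : (s (s x) == x) = false. Proof. by case: (iter_neq x). Qed.
Let s3 x : (s (s (s x)) == x) = false. Proof. by case: (iter_neq x). Qed.
Let s4 x : (s (s (s (s x))) == x) = false. Proof. by case: (iter_neq x). Qed.
Let s1' x : (x == s x) = false. Proof. by rewrite eq_sym s1. Qed.
Let s2' x : (x == s (s x)) = false. Proof. by rewrite eq_sym s2. Qed.
Let s3' x : (x == s (s (s x))) = false. Proof. by rewrite eq_sym s3. Qed.
Let s4' x : (x == s (s (s (s x)))) = false. Proof. by rewrite eq_sym s4. Qed.
Let sE := (inj_eq s_inj, s1, s2, s3, s4, s1', s2', s3', s4').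

Let pred_of x : exists w, x = s w.
Proof. by exists (finv s x); rewrite f_finv. Qed.

Definition succ_adj : rel V := fun x y => (s x == y) || (s y == x).

Lemma succ_adj_sym : symmetric succ_adj.
Proof. by move=> x y; rewrite /succ_adj orbC. Qed.

Lemma succ_adj_irrefl : irreflexive succ_adj.
Proof. by move=> x; rewrite /succ_adj s1. Qed.

Definition succ_graph : sgraph V := SGraph succ_adj_sym succ_adj_irrefl.

Lemma succ_graph_regular : regular succ_graph 2.
Proof.
move=> x; have [w ->] := pred_of x.
have -> : 2 = #|[set s (s w); w]| by rewrite cards2 s2.
apply: eq_card => y; rewrite !inE /= /succ_adj (inj_eq s_inj).
by rewrite [s (s w) == y]eq_sym.
Qed.

(** A walk that does not turn back keeps its orientation, since s is injective;
    so a graph cycle of length 3 or 4 would be a cycle of s. *)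
Lemma succ_adj_turn x y z : succ_adj x y -> succ_adj y z -> x != z ->
  (s x = y /\ s y = z) \/ (s y = x /\ s z = y).
Proof.
by move=> /orP[] /eqP ? /orP[] /eqP ? /eqP ?; subst; try tauto;
  exfalso; auto.
Qed.

Lemma succ_graph_girth (x0 : V) : girth_at_least succ_graph 5.
Proof.
have ord5 : 4 < order s x0.
  rewrite leqNgt; apply/negP => lt5.
  have := @s_order x0 (order s x0); rewrite lt5 iter_order // eqxx.
  by rewrite order_gt0 => /(_ isT).
apply: (@girth_exists _ _ _ (orbit s x0)).
  rewrite /graph_cycle /ucycleb size_orbit (leq_trans _ ord5) //=.
  rewrite orbit_uniq andbT.
  apply: sub_cycle (cycle_orbit s_inj x0) => x y /eqP <-.
  by rewrite /= /succ_adj eqxx.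
have s3P x : s (s (s x)) <> x by apply/eqP; rewrite s3.
have s4P x : s (s (s (s x))) <> x by apply/eqP; rewrite s4.
case=> [|a [|b [|c [|d [|e c']]]]] //; rewrite /graph_cycle /ucycleb /= ?inE.
  rewrite !andbT !negb_or -!andbA.
  move=> /and5P[ab bc ca /eqP neq_ab /andP[/eqP neq_ac /eqP neq_bc]].
  have := succ_adj_turn ab bc (introN eqP neq_ac).
  have := succ_adj_turn bc ca (introN eqP (not_eq_sym neq_ab)).
  have s3a := s3P a; have s3c := s3P c.
  clear - neq_ab neq_ac neq_bc s3a s3c.
  by move=> [[? ?]|[? ?]] [[? ?]|[? ?]]; congruence.
rewrite !andbT !negb_or -!andbA => /and5P[ab bc cd da].
move=> /and5P[_ /eqP neq_ac _ _ /andP[/eqP neq_bd _]].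
have := succ_adj_turn ab bc (introN eqP neq_ac).
have := succ_adj_turn bc cd (introN eqP neq_bd).
have := succ_adj_turn cd da (introN eqP (not_eq_sym neq_ac)).
have s4a := s4P a; have s4d := s4P d.
clear - neq_ac neq_bd s4a s4d.
by move=> [[? ?]|[? ?]] [[? ?]|[? ?]] [[? ?]|[? ?]]; congruence.
Qed.

Lemma far_irrefl : irreflexive far.
Proof. by move=> x; rewrite /far eqxx. Qed.

Lemma card_far x : #|[set y | far x y]| = #|V| - 5.
Proof.
have [w ->] := pred_of x; have [v ->] := pred_of w.
have -> : [set y | far (s (s v)) y]
    = ~: [set y in [:: v; s v; s (s v); s (s (s v)); s (s (s (s v)))]].
  apply/setP => y; rewrite !inE /far; congr (~~ _).
  rewrite !(inj_eq s_inj) [s (s v) == y]eq_sym [s (s (s v)) == y]eq_sym.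
  by rewrite [s (s (s (s v))) == y]eq_sym; do 5!case: (y == _).
rewrite cardsCs setCK cardsE; congr (_ - _).
by apply/card_uniqP; rewrite /= !inE !sE.
Qed.

Lemma card_far_pairs : #|[set p : V * V | far p.1 p.2]| = #|V| * (#|V| - 5).
Proof.
rewrite -sum1_card -sum_nat_const.
rewrite (eq_bigl (fun p : V * V => xpredT p.1 && far p.1 p.2)); last first.
  by move=> p; rewrite inE.
rewrite -(pair_big_dep xpredT far (fun _ _ => 1)) /=.
apply: eq_bigr => x _; rewrite -(card_far x) -sum1_card.
by apply: eq_bigl => y; rewrite inE.
Qed.

Local Notation N := (closed_nbhd succ_graph).

Lemma in_closed_nbhd w z :
  (s w \in N z) = [|| z == w, z == s w | z == s (s w)].
Proof.
rewrite !inE /= /succ_adj (inj_eq s_inj) [s w == z]eq_sym [s (s w) == z]eq_sym.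
by do 3!case: (z == _).
Qed.

Lemma closed_nbhd_adj x z :
  (x \in N z) && (s x \in N z) = (z == x) || (z == s x).
Proof.
have [w ->] := pred_of x; rewrite !in_closed_nbhd.
case: (z =P s w) => [->|_]; first by rewrite !orbT.
case: (z =P s (s w)) => [->|_]; first by rewrite !orbT.
rewrite !orbF /=; case: (z =P w) => [->|] //; by rewrite !sE.
Qed.

Lemma closed_nbhd_path x z :
  (x \in N z) && (s (s x) \in N z) = (z == s x).
Proof.
have [w ->] := pred_of x; rewrite !in_closed_nbhd.
case: (z =P s (s w)) => [->|_]; first by rewrite !orbT.
rewrite !orbF /=; case: (z =P w) => [->|_] /=; first by rewrite !sE.
by case: (z =P s w) => [->|_] //=; rewrite !sE.
Qed.

Lemma closed_nbhd_near x y z : x \in N z -> y \in N z -> ~~ far x y.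
Proof.
rewrite negbK; have [w ->] := pred_of x; have [v ->] := pred_of y.
rewrite !in_closed_nbhd !(inj_eq s_inj).
rewrite [s v == w]eq_sym [s (s v) == w]eq_sym.
by move=> /or3P[] /eqP-> /or3P[]; rewrite ?(inj_eq s_inj) => ->; rewrite ?orbT.
Qed.

Variable U : {set {set V}}.
Hypothesis szU : forall b, b \in U -> #|b| <= 3.
Hypothesis covU :
  forall x y, far x y -> exists2 b, b \in U & (x \in b) && (y \in b).
Hypothesis leU : #|U| * 6 <= #|V| * (#|V| - 5).

Let B := U :|: [set N z | z in V].

Let exactU : (forall b, b \in U -> #|b| = 3) /\
  (forall x y, x != y -> pair_count U x y = far x y).
Proof.
apply: exact_cover_of_count => //; first exact: far_irrefl.
by rewrite card_far_pairs.
Qed.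

Let U_far b x y : b \in U -> x \in b -> y \in b -> x != y -> far x y.
Proof.
move=> bU xb yb neq_xy; have := exactU.2 x y neq_xy; case: far => // /eqP.
by rewrite cards_eq0 => /eqP/setP/(_ b); rewrite !inE bU xb yb.
Qed.

Let N_neq x : N x != N (s x).
Proof.
have [w ->] := pred_of x; apply/eqP => /setP/(_ w).
by rewrite !inE /= /succ_adj !sE eqxx.
Qed.

Let notU x y b : ~~ far x y -> x != y -> b \in B -> x \in b -> y \in b ->
  exists2 z, b = N z & (x \in N z) && (y \in N z).
Proof.
move=> nfar neq_xy /setUP[bU xb yb|/imsetP[z _ ->] xb yb].
  by rewrite (U_far bU xb yb neq_xy) in nfar.
by exists z; rewrite // xb.
Qed.

Lemma pair_count_far x y : far x y -> pair_count B x y = 1.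
Proof.
move=> far_xy; have neq_xy : x != y.
  by apply: contraTneq far_xy => ->; rewrite far_irrefl.
transitivity (pair_count U x y); last by rewrite exactU.2 ?far_xy.
apply: eq_card => b; rewrite !inE; case: (b \in U) => //=.
apply/negbTE/andP => -[/imsetP[z _ ->] /andP[xz yz]].
by have := closed_nbhd_near xz yz; rewrite far_xy.
Qed.

Lemma pair_count_path x : pair_count B x (s (s x)) = 1.
Proof.
rewrite -(cards1 (N (s x))); apply: eq_card => b; rewrite [LHS]inE.
apply/andP/set1P => [[bB /andP[xb yb]]|->]; last first.
  rewrite closed_nbhd_path eqxx; split=> //.
  by apply/setUP; right; apply: imset_f.
have [||z -> ] := notU _ _ bB xb yb; rewrite ?s2' //.
  by rewrite negbK eqxx !orbT.
by rewrite closed_nbhd_path => /eqP ->.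
Qed.

Lemma pair_count_adj x : pair_count B x (s x) = 2.
Proof.
have -> : 2 = #|[set N x; N (s x)]| by rewrite cards2 N_neq.
apply: eq_card => b; rewrite [LHS]inE.
apply/andP/set2P => [[bB /andP[xb yb]]|]; last first.
  case=> ->; rewrite closed_nbhd_adj eqxx ?orbT; split=> //;
  by apply/setUP; right; apply: imset_f.
have [||z -> ] := notU _ _ bB xb yb; rewrite ?s1' //.
  by rewrite negbK eqxx !orbT.
by rewrite closed_nbhd_adj => /orP[] /eqP ->; [left | right].
Qed.

Lemma pair_countC (W : {set {set V}}) x y : pair_count W x y = pair_count W y x.
Proof. by apply: eq_card => b; rewrite !inE [(x \in b) && _]andbC. Qed.

Lemma successor_design : is_design succ_graph 2 B.
Proof.
have nonadj x y : x != y -> ~~ succ_adj x y -> pair_count B x y = 1.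
  move=> neq_xy; case far_xy: (far x y); first by rewrite pair_count_far.
  move/negbFE: far_xy; rewrite (negbTE neq_xy) /= => /or4P[] /eqP E.
  - by rewrite /succ_adj E eqxx.
  - by rewrite /succ_adj E eqxx orbT.
  - by rewrite -E pair_count_path.
  - by rewrite -E pair_countC pair_count_path.
have adj x y : succ_adj x y -> pair_count B x y = 2.
  by case/orP=> /eqP <-; [|rewrite pair_countC]; apply: pair_count_adj.
have szB b : b \in B -> #|b| = 3.
  case/setUP=> [bU|/imsetP[z _ ->]]; first exact: exactU.1.
  rewrite /closed_nbhd cardsU1 succ_graph_regular.
  by rewrite inE /= succ_adj_irrefl.
split=> //; last by move=> x; apply/setUP; right; apply: imset_f.
exists ((#|V|.-1 + 2) %/ 2) => x.
by rewrite -(replication_number (succ_graph_regular x) szB) ?mulnK //; auto.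
Qed.

Lemma successor_design_of_order (x0 : V) : design_of_order #|V|.
Proof.
exists V, succ_graph; split=> //.
- exact: succ_graph_regular.
- exact: succ_graph_girth x0.
- by exists B; apply: successor_design.
Qed.

End Successor.

(** * Difference methods in a finite abelian group *)

Section Develop.

Local Open Scope ring_scope.

Variable Z : finZmodType.

Definition develop (ab : Z * Z) (x : Z) : {set Z} :=
  [set x; x + ab.1; x + ab.1 + ab.2].

Definition is_diff (ab : Z * Z) (g : Z) : bool :=
  [|| g == ab.1, g == ab.2 | g == ab.1 + ab.2].

Lemma develop_cover ab x y : is_diff ab (y - x) ->
  exists z, (x \in develop ab z) && (y \in develop ab z).
Proof.
case/or3P=> /eqP g_eq; have -> : y = x + (y - x) by rewrite subrKC.
- by exists x; rewrite !inE g_eq !eqxx !orbT.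
- by exists (x - ab.1); rewrite !inE g_eq !subrK !eqxx !orbT.
- by exists x; rewrite !inE g_eq addrA !eqxx !orbT.
Qed.

(** The index set consists of the positions in D, so that its cardinality is
    known even if D has repetitions. *)
Definition developed (D : seq (Z * Z)) : {set {set Z}} :=
  [set develop (tnth (in_tuple D) p.1) p.2 | p : 'I_(size D) * Z].

Lemma card_developed D : (#|developed D| <= size D * #|Z|)%N.
Proof.
by apply: leq_trans (leq_imset_card _ _) _; rewrite card_prod card_ord.
Qed.

Lemma card_le3 (T : finType) (a b c : T) : (#|[set a; b; c]| <= 3)%N.
Proof. by rewrite setUC cardsU1 cards2; lia. Qed.

Lemma developed_size D b : b \in developed D -> (#|b| <= 3)%N.
Proof. by case/imsetP=> p _ ->; apply: card_le3. Qed.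

Lemma developed_cover D ab x y : ab \in D ->
    is_diff ab (y - x) || is_diff ab (x - y) ->
  exists2 b, b \in developed D & (x \in b) && (y \in b).
Proof.
move=> /(tnthP (in_tuple D))[i ->] diff.
have [z z_xy] : exists z, (x \in develop (tnth (in_tuple D) i) z)
                       && (y \in develop (tnth (in_tuple D) i) z).
  by case/orP: diff => /develop_cover[z]; exists z => //; rewrite andbC.
by exists (develop (tnth (in_tuple D) i) z) => //; apply/imsetP; exists (i, z).
Qed.

Variable e : Z.
Hypothesis e_order : forall k, (0 < k < 5)%N -> e *+ k != 0.

Let shift (x : Z) : Z := x + e.

Lemma shift_inj : injective shift. Proof. exact: addIr. Qed.

Lemma shift_order x k : (0 < k < 5)%N -> iter k shift x != x.
Proof.
suff -> : iter k shift x = x + e *+ k.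
  by move=> /e_order; rewrite -[X in _ + _ == X]addr0 (inj_eq (addrI x)).
by elim: k => [|k IHk]; rewrite ?addr0 //= IHk mulrSr addrA.
Qed.

Lemma translation_design (D : seq (Z * Z)) :
    (forall x y, far shift x y ->
       exists2 ab, ab \in D & is_diff ab (y - x) || is_diff ab (x - y)) ->
    (size D * 6 <= #|Z| - 5)%N ->
  design_of_order #|Z|.
Proof.
move=> covD szD.
apply: (@successor_design_of_order _ _ shift_inj shift_order
  (developed D) _ _ _ 0).
- exact: developed_size.
- by move=> x y /covD[ab abD]; apply: developed_cover.
- rewrite (leq_trans (leq_mul (card_developed D) (leqnn 6))) // mulnAC mulnC.
  by rewrite leq_mul2l szD orbT.
Qed.

(** The points at infinity are labelled by the matchings they are joined to: the
    matching of odd difference [o k] that starts at the elements of parity b for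
    [Some (k, b)], and the matching of difference N/2 for [None]. *)
Definition infinity : finType := option (bool * bool).

Definition next_infinity (i : infinity) : infinity :=
  match i with
  | None => Some (false, false)
  | Some (false, false) => Some (false, true)
  | Some (false, true) => Some (true, false)
  | Some (true, false) => Some (true, true)
  | Some (true, true) => None
  end.

Definition shift_oo (v : Z + infinity) : Z + infinity :=
  match v with inl x => inl (shift x) | inr i => inr (next_infinity i) end.

Lemma shift_oo_inj : injective shift_oo.
Proof.
move=> [x|i] [y|j] //=; first by case=> /shift_inj ->.
by case: i j => [[[] []]|] [[[] []]|].
Qed.

Lemma shift_oo_order v k : (0 < k < 5)%N -> iter k shift_oo v != v.
Proof.
case: v => [x|i].
  have -> : iter k shift_oo (inl x) = inl (iter k shift x).
    by elim: k => //= k ->.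
  exact: shift_order.
by case: i k => [[[] []]|] [|[|[|[|[|k]]]]].
Qed.

Variables (D : seq (Z * Z)) (o : bool -> Z) (parity : Z -> bool).
Variables (h : Z) (H : {set Z}).

Definition odd_block (k : bool) (x : Z) : {set Z + infinity} :=
  [set inr (Some (k, parity x)); inl x; inl (x + o k)].

Definition half_block (x : Z) : {set Z + infinity} :=
  [set inr None; inl x; inl (x + h)].

Definition blocks_oo : {set {set Z + infinity}} :=
  [set [set inl x | x in b] | b : {set Z} in developed D]
    :|: [set odd_block p.1 p.2 | p : bool * Z]
    :|: [set half_block x | x in H].

Hypothesis parity_odd : forall k x, parity (x + o k) = ~~ parity x.
Hypothesis h_half : h + h = 0.
Hypothesis H_half : forall x, (x \in H) || (x + h \in H).

Lemma odd_block_in k x : odd_block k x \in blocks_oo.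
Proof.
rewrite !inE; apply/orP; left; apply/orP; right.
by apply/imsetP; exists (k, x).
Qed.

Lemma half_block_cover x : exists2 b, b \in blocks_oo &
  [&& inr None \in b, inl x \in b & inl (x + h) \in b].
Proof.
have [xH|xhH] := orP (H_half x);
  [exists (half_block x) | exists (half_block (x + h))];
  rewrite ?inE ?imset_f ?orbT // ?inE ?eqxx ?orbT //.
by rewrite -addrA h_half addr0 eqxx !orbT.
Qed.

(** Since [o k] changes the parity, exactly one of x and x - o k has the parity
    required by the point at infinity. *)
Lemma odd_block_cover i x :
  exists2 b, b \in blocks_oo & (inr i \in b) && (inl x \in b).
Proof.
case: i => [[k b]|]; last first.
  have [b bB /and3P[? ? _]] := half_block_cover x.
  by exists b => //; apply/andP.
have [<-|neq] := eqVneq (parity x) b.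
  by exists (odd_block k x); rewrite ?odd_block_in // !inE !eqxx !orbT.
exists (odd_block k (x - o k)); rewrite ?odd_block_in //.
rewrite !inE subrK !eqxx !orbT andbT.
have := parity_odd k (x - o k); rewrite subrK => par_x.
suff -> : parity (x - o k) = b by rewrite eqxx.
by move: neq; rewrite par_x; case: (parity _) b => [] [].
Qed.

Hypothesis covD : forall x y, far shift x y ->
  [\/ exists2 ab, ab \in D & is_diff ab (y - x) || is_diff ab (x - y),
      exists k, (y - x == o k) || (x - y == o k)
    | y - x = h].
Hypothesis szD : (size D * 6 + 10 <= #|Z|)%N.
Hypothesis szH : (#|H| * 2 <= #|Z|)%N.

Lemma blocks_oo_cover v w : far shift_oo v w ->
  exists2 b, b \in blocks_oo & (v \in b) && (w \in b).
Proof.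
case: v w => [x|i] [y|j]; last first.
- by case: i j => [[[] []]|] [[[] []]|].
- by move=> _; apply: odd_block_cover.
- by move=> _; have [b] := odd_block_cover j x; exists b; rewrite // andbC.
move=> far_xy; have {far_xy} : far shift x y by [].
case/covD => [[ab abD diff]|[k diff]|diff].
- have [b bD /andP[xb yb]] := developed_cover abD diff.
  exists [set inl x | x in b]; last first.
    by rewrite !mem_imset //; [apply/andP | move=> ? ? [] | move=> ? ? []].
  by rewrite !inE imset_f.
- case/orP: diff => /eqP diff;
    [exists (odd_block k x) | exists (odd_block k y)];
    rewrite ?odd_block_in // !inE -diff subrKC !eqxx !orbT //.
have [b bB /and3P[_ xb]] := half_block_cover x.
by rewrite -diff subrKC => yb; exists b => //; apply/andP.
Qed.

Lemma blocks_oo_size b : b \in blocks_oo -> (#|b| <= 3)%N.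
Proof.
rewrite !inE => /orP[/orP[]|] /imsetP[]; last by move=> x _ ->; apply: card_le3.
  move=> c /developed_size sz_c ->.
  exact: leq_trans (leq_imset_card _ _) sz_c.
by move=> p _ ->; apply: card_le3.
Qed.

Lemma card_blocks_oo :
  (#|blocks_oo| <= size D * #|Z| + 2 * #|Z| + #|H|)%N.
Proof.
have leU (T : finType) (A B : {set T}) : (#|A :|: B| <= #|A| + #|B|)%N.
  by rewrite cardsU leq_subr.
apply: leq_trans (leU _ _ _) _; apply: leq_add; last exact: leq_imset_card.
apply: leq_trans (leU _ _ _) _; apply: leq_add.
  exact: leq_trans (leq_imset_card _ _) (card_developed D).
by apply: leq_trans (leq_imset_card _ _) _; rewrite card_prod card_bool.
Qed.

Lemma translation_infinity_design : design_of_order (#|Z| + 5).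
Proof.
have card_V : #|{: Z + infinity}| = (#|Z| + 5)%N.
  by rewrite card_sum card_option card_prod card_bool.
rewrite -card_V.
apply: (@successor_design_of_order _ _ shift_oo_inj shift_oo_order
  blocks_oo _ _ _ (inl 0)).
- exact: blocks_oo_size.
- exact: blocks_oo_cover.
rewrite card_V addnK; have le_B := card_blocks_oo.
have le_sz : ((size D * 6 + 10) * #|Z| <= #|Z| * #|Z|)%N by rewrite leq_mul.
move: #|blocks_oo| #|H| #|Z| (size D) le_B szH le_sz => B m z d; lia.
Qed.

End Develop.

(** * Difference methods modulo an integer *)

Section Residues.

Local Open Scope ring_scope.

Variable n : nat.
Local Notation Z := 'I_n.+1.
Local Notation res := (@inZp n).

Lemma inZpD a b : res (a + b)%N = res a + res b.
Proof. by apply: val_inj; rewrite /= modnDm. Qed.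

Lemma inZp_eq0 a : (res a == 0) = (n.+1 %| a)%N.
Proof. by rewrite -val_eqE /= /dvdn. Qed.

Lemma inZp_mulrn a k : res a *+ k = res (k * a)%N.
Proof.
elim: k => [|k IHk]; last by rewrite mulrS IHk mulSn inZpD.
by apply: val_inj.
Qed.

Lemma inZp_opp a b : (a + b = n.+1)%N -> res a = - res b.
Proof.
move=> ab; apply/eqP; rewrite -subr_eq0 opprK -inZpD ab inZp_eq0.
exact: dvdnn.
Qed.

Lemma short_difference (x y : Z) : x != y ->
  exists d, [/\ (0 < d)%N, (d.*2 <= n.+1)%N & y - x = res d \/ x - y = res d].
Proof.
move=> neq_xy; pose g := y - x; have g_gt0 : (0 < val g)%N.
  rewrite lt0n; apply: contraNneq neq_xy => g0.
  by rewrite eq_sym -subr_eq0 -val_eqE; apply/eqP.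
have lt_g : (val g < n.+1)%N := ltn_ord g.
have [le_g|gt_g] := leqP (val g).*2 n.+1.
  by exists (val g); split=> //; left; rewrite valZpK.
exists (n.+1 - val g)%N; split; [by lia | by lia | right].
rewrite -opprB -/g (@inZp_opp _ (val g)) ?valZpK //.
exact: subnK (ltnW lt_g).
Qed.

(** Differences are taken up to sign and represented by integers of at most half
    the modulus; the last alternative is the representative of a + b when a + b
    exceeds that. *)
Definition nat_diff (d : nat) (ab : nat * nat) : bool :=
  [|| d == ab.1, d == ab.2, d == (ab.1 + ab.2)%N
    | (d + (ab.1 + ab.2) == n.+1)%N].

Definition res2 (ab : nat * nat) : Z * Z := (res ab.1, res ab.2).

Lemma nat_diff_res d ab (x y : Z) : nat_diff d ab ->
    y - x = res d \/ x - y = res d ->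
  is_diff (res2 ab) (y - x) || is_diff (res2 ab) (x - y).
Proof.
rewrite /is_diff /= -inZpD.
case/or4P=> /eqP d_eq; rewrite ?d_eq; try by case=> ->; rewrite eqxx ?orbT.
by case=> E; [rewrite -[x - y]opprB | rewrite -[y - x]opprB];
  rewrite E (inZp_opp d_eq) opprK eqxx ?orbT.
Qed.

Lemma far_diff_neq (e d f : nat) (x y : Z) :
    (f = e.*2 \/ f + e.*2 = n.+1)%N ->
    y - x = res d \/ x - y = res d ->
    far (fun z : Z => z + res e) x y ->
  d != e /\ d != f.
Proof.
rewrite /far !negb_or => f_eq xy /and5P[_ H1 H2 H3 H4].
have shiftE (u v : Z) k : v - u = res k -> u + res k = v.
  by move=> <-; rewrite subrKC.
split; apply/eqP => d_eq; rewrite d_eq in xy.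
  by case: xy => /shiftE xy; [case/eqP: H1 | case/eqP: H2].
have {H3 H4} : x + res e.*2 != y /\ y + res e.*2 != x.
  by rewrite -addnn inZpD !addrA.
case: f_eq xy => [->|/inZp_opp ->]; first by case=> /shiftE -> []; rewrite eqxx.
case=> /eqP; rewrite subr_eq => /eqP ->; rewrite [- _ + _]addrC subrK eqxx;
  by case.
Qed.

Variables (e f : nat) (D : seq (nat * nat)).
(* The multiple k * e lies strictly between two consecutive multiples of the
   modulus, hence is not divisible by it. *)
Hypothesis e_order : forall k, (0 < k < 5)%N ->
  exists q, (q * n.+1 < k * e < q.+1 * n.+1)%N.
Hypothesis f_eq : (f = e.*2 \/ f + e.*2 = n.+1)%N.

Let res_order k : (0 < k < 5)%N -> res e *+ k != 0.
Proof.
move=> /e_order[q /andP[lo hi]]; rewrite inZp_mulrn inZp_eq0.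
apply/dvdnP => -[r r_eq]; move: lo hi; rewrite r_eq !ltn_mul2r /=.
by rewrite ltnS => lt_qr; rewrite leqNgt lt_qr.
Qed.

Lemma cyclic_difference_design :
    (forall d, 0 < d -> d.*2 <= n.+1 -> d != e -> d != f ->
      has (nat_diff d) D)%N ->
    (size D * 6 + 5 <= n.+1)%N ->
  design_of_order n.+1.
Proof.
move=> covD szD; rewrite -[n.+1]card_ord.
apply: (translation_design res_order (D := map res2 D)); last first.
  by rewrite size_map card_ord; lia.
move=> x y far_xy; have neq_xy : x != y.
  by apply: contraNneq far_xy => ->; rewrite eqxx.
have [d [d_gt0 d_le xy]] := short_difference neq_xy.
have [de df] := far_diff_neq f_eq xy far_xy.
have /hasP[ab abD diff] := covD d d_gt0 d_le de df.
by exists (res2 ab); [apply: map_f | apply: nat_diff_res diff xy].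
Qed.

Lemma cyclic_infinity_design (o1 o2 m : nat) :
    n.+1 = m.*2 -> odd o1 -> odd o2 ->
    (forall d, 0 < d < m -> [&& d != e, d != f, d != o1 & d != o2] ->
      has (nat_diff d) D)%N ->
    (size D * 6 + 10 <= n.+1)%N ->
  design_of_order (n.+1 + 5).
Proof.
move=> n_eq o1_odd o2_odd covD szD.
have -> : (n.+1 + 5 = #|Z| + 5)%N by rewrite card_ord.
have val_odd (x : Z) k : odd (val (x + res k)) = odd (val x) (+) odd k.
  have par a : odd (a %% n.+1) = odd a.
    by rewrite {2}(divn_eq a n.+1) oddD oddM n_eq odd_double andbF.
  by rewrite /= par oddD par.
pose o (k : bool) := res (if k then o2 else o1).
apply: (@translation_infinity_design _ (res e) res_order (map res2 D) o
  (fun x => odd (val x)) (res m) [set res i | i : 'I_m]).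
- by move=> [] x; rewrite val_odd ?o1_odd ?o2_odd addbT.
- by rewrite -inZpD addnn -n_eq; apply/eqP; rewrite inZp_eq0.
- move=> x; have [lt_xm|le_mx] := ltnP (val x) m; apply/orP; [left | right].
    by apply/imsetP; exists (Ordinal lt_xm); rewrite //= valZpK.
  have lt_x : (val x < m.*2)%N by rewrite -n_eq; exact: ltn_ord.
  have lt_xm : (val x - m < m)%N by move: (val x) lt_x => v; lia.
  apply/imsetP; exists (Ordinal lt_xm) => //=.
  rewrite -{1}[x]valZpK -inZpD; apply: val_inj => /=.
  have wrap v : (m <= v -> v + m = v - m + n.+1)%N by rewrite n_eq; lia.
  rewrite wrap //.
  by rewrite modnDr.
- move=> x y far_xy; have neq_xy : x != y.
    by apply: contraNneq far_xy => ->; rewrite eqxx.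
  have [d [d_gt0 d_le xy]] := short_difference neq_xy.
  have [de df] := far_diff_neq f_eq xy far_xy.
  have [d_eq|dm] := eqVneq d m.
    constructor 3; case: xy => xy; first by rewrite xy d_eq.
    rewrite -opprB xy d_eq -(@inZp_opp m) //; lia.
  have [d_eq|do1] := eqVneq d o1.
    constructor 2; exists false; rewrite /o -d_eq.
    by case: xy => ->; rewrite eqxx ?orbT.
  have [d_eq|do2] := eqVneq d o2.
    constructor 2; exists true; rewrite /o -d_eq.
    by case: xy => ->; rewrite eqxx ?orbT.
  constructor 1; have /hasP[ab abD diff] : has (nat_diff d) D.
    by apply: covD; [lia | rewrite de df do1].
  by exists (res2 ab); [apply: map_f | apply: nat_diff_res diff xy].
- by rewrite size_map card_ord.
have le_m : (m * 2 <= n.+1)%N by rewrite n_eq muln2.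
rewrite card_ord (leq_trans _ le_m) // leq_mul2r.
by apply: leq_trans (leq_imset_card _ _) _; rewrite card_ord.
Qed.

End Residues.

(** * Nested differences and the four families *)

(** The pairs (2j, c - j) stand for the triples (2j, c - j, c + j), and the
    pairs (2j + 1, c - j) for the triples (2j + 1, c - j, c + j + 1). *)
Definition even_nest (c lo hi : nat) : seq (nat * nat) :=
  [seq (j.*2, c - j) | j <- iota lo (hi - lo)].

Definition odd_nest (c lo hi : nat) : seq (nat * nat) :=
  [seq (j.*2.+1, c - j) | j <- iota lo (hi - lo)].

Definition even_nest_span (c lo hi d : nat) : bool :=
  [|| (lo.*2 <= d < hi.*2) && ~~ odd d, (c < d + hi) && (d + lo <= c)
    | c + lo <= d < c + hi].

Definition odd_nest_span (c lo hi d : nat) : bool :=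
  [|| (lo.*2 < d < hi.*2) && odd d, (c < d + hi) && (d + lo <= c)
    | c + lo < d <= c + hi].

Lemma size_even_nest c lo hi : size (even_nest c lo hi) = hi - lo.
Proof. by rewrite size_map size_iota. Qed.

Lemma size_odd_nest c lo hi : size (odd_nest c lo hi) = hi - lo.
Proof. by rewrite size_map size_iota. Qed.

Lemma even_nest_cover n c lo hi d :
  hi <= c.+1 -> even_nest_span c lo hi d ->
  has (nat_diff n d) (even_nest c lo hi).
Proof.
move=> le_c d_in.
have [j j_in d_eq] :
    exists2 j, lo <= j < hi & [|| d == j.*2, d + j == c | d == c + j].
  by case/or3P: d_in => d_in; [exists d./2 | exists (c - d) | exists (d - c)];
    lia.
apply/hasP; exists (j.*2, c - j); last by rewrite /nat_diff /=; lia.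
by apply/mapP; exists j; rewrite // mem_iota; lia.
Qed.

Lemma odd_nest_cover n c lo hi d :
  hi <= c.+1 -> odd_nest_span c lo hi d ->
  has (nat_diff n d) (odd_nest c lo hi).
Proof.
move=> le_c d_in.
have [j j_in d_eq] :
    exists2 j, lo <= j < hi & [|| d == j.*2.+1, d + j == c | d == (c + j).+1].
  by case/or3P: d_in => d_in;
    [exists d./2 | exists (c - d) | exists (d - c.+1)]; lia.
apply/hasP; exists (j.*2.+1, c - j); last by rewrite /nat_diff /=; lia.
by apply/mapP; exists j; rewrite // mem_iota; lia.
Qed.

(** The even nest is centred at e = 3p + 1 and spans [2p+1, 4p+1]; the odd nest
    spans [4p+2, 6p+1].  What is left of {1, ..., 6p+2} is e and 2e = 6p + 2. *)
Lemma design_12p_5 p : design_of_order (12 * p + 5).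
Proof.
have -> : 12 * p + 5 = (12 * p + 4).+1 by lia.
apply: (@cyclic_difference_design _ (3 * p + 1) (6 * p + 2)
  (even_nest (3 * p + 1) 1 p.+1 ++ odd_nest (5 * p + 1) 0 p)).
- by case=> [|[|[|[|[|k]]]]] // _; exists 0; lia.
- by left; lia.
- move=> d d_gt0 d_le de df; rewrite has_cat; apply/orP.
  have [in_even|] := boolP (even_nest_span (3 * p + 1) 1 p.+1 d).
    by left; apply: even_nest_cover in_even; lia.
  rewrite /even_nest_span => not_even.
  by right; apply: odd_nest_cover; rewrite /odd_nest_span; lia.
- by rewrite size_cat size_even_nest size_odd_nest; lia.
Qed.

(** Here e = 5p + 10 and 2e is 2p + 3 up to sign.  The odd nest is centred
    between e and e + 1 but starts at the difference 3, which leaves 1 and e + 1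
    unused, besides e.  These two, the centre 3p + 5 of the even nest, and the
    numbers 4p + 7, 4p + 8 and 4p + 9 between the two spans form the two
    exceptional triples, of which the first has sum n. *)
Lemma design_12p_23 p : design_of_order (12 * p + 23).
Proof.
have -> : 12 * p + 23 = (12 * p + 22).+1 by lia.
apply: (@cyclic_difference_design _ (5 * p + 10) (2 * p + 3)
  (even_nest (3 * p + 5) 1 p.+2 ++ odd_nest (5 * p + 10) 1 p.+1
     ++ [:: (3 * p + 5, 4 * p + 7); (1, 4 * p + 8)])).
- case=> [|[|[|[|[|k]]]]] // _; [exists 0 | exists 0 | exists 1 | exists 1];
    lia.
- by right; lia.
- move=> d d_gt0 d_le de df; rewrite !has_cat.
  case: (boolP (has _ [:: _; _])) => [_|]; first by rewrite !orbT.
  move=> not_exc; rewrite orbF; apply/orP.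
  rewrite /= /nat_diff /= !negb_or in not_exc.
  have [in_even|] := boolP (even_nest_span (3 * p + 5) 1 p.+2 d).
    by left; apply: even_nest_cover in_even; lia.
  rewrite /even_nest_span !negb_or => not_even.
  by right; apply: odd_nest_cover; rewrite /odd_nest_span; lia.
- by rewrite !size_cat size_even_nest size_odd_nest /=; lia.
Qed.

(** With N = 12p + 10: the even nest is centred at e = 3p + 2 and spans
    [2p+2, 4p+2], the odd nest spans [4p+4, 6p+3].  What is left of
    {1, ..., 6p+5} is e, 2e = 6p + 4, the odd numbers 2p + 1 and 4p + 3, and
    N/2 = 6p + 5. *)
Lemma design_12p_15 p : design_of_order (12 * p + 15).
Proof.
have -> : 12 * p + 15 = (12 * p + 9).+1 + 5 by lia.
apply: (@cyclic_infinity_design _ (3 * p + 2) (6 * p + 4)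
  (even_nest (3 * p + 2) 1 p.+1 ++ odd_nest (5 * p + 3) 0 p) _ _
  (2 * p + 1) (4 * p + 3) (6 * p + 5)); try lia.
- by case=> [|[|[|[|[|k]]]]] // _; exists 0; lia.
- move=> d d_in d_neq; rewrite has_cat; apply/orP.
  have [in_even|] := boolP (even_nest_span (3 * p + 2) 1 p.+1 d).
    by left; apply: even_nest_cover in_even; lia.
  rewrite /even_nest_span => not_even.
  by right; apply: odd_nest_cover; rewrite /odd_nest_span; lia.
- by rewrite size_cat size_even_nest size_odd_nest; lia.
Qed.

(** With N = 12p + 16: the odd nest spans [2p+5, 4p+4], and the even nest,
    centred at e = 5p + 6, spans [4p+5, 6p+7].  What is left of
    {1, ..., 6p+8} is e, the number 2p + 4 = N - 2e, the odd numbers 2p + 1 and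
    2p + 3, and N/2 = 6p + 8. *)
Lemma design_12p_21 p : design_of_order (12 * p + 21).
Proof.
have -> : 12 * p + 21 = (12 * p + 15).+1 + 5 by lia.
apply: (@cyclic_infinity_design _ (5 * p + 6) (2 * p + 4)
  (even_nest (5 * p + 6) 1 p.+2 ++ odd_nest (3 * p + 4) 0 p) _ _
  (2 * p + 1) (2 * p + 3) (6 * p + 8)); try lia.
- case=> [|[|[|[|[|k]]]]] // _; [exists 0 | exists 0 | exists 1 | exists 1];
    lia.
- move=> d d_in d_neq; rewrite has_cat; apply/orP.
  have [in_even|] := boolP (even_nest_span (5 * p + 6) 1 p.+2 d).
    by left; apply: even_nest_cover in_even; lia.
  rewrite /even_nest_span => not_even.
  by right; apply: odd_nest_cover; rewrite /odd_nest_span; lia.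
- by rewrite size_cat size_even_nest size_odd_nest; lia.
Qed.

Lemma design_of_order_exists (n : nat) :
  5 <= n -> n = 3 %[mod 6] \/ n = 5 %[mod 6] -> ~ (n = 9 \/ n = 11) ->
  design_of_order n.
Proof.
move=> n_ge5 n_mod n_neq.
have : exists p, [\/ n = 12 * p + 5, n = 12 * p + 23, n = 12 * p + 15
                   | n = 12 * p + 21].
  exists (if n %% 12 == 5 then n %/ 12 else
          if n %% 12 == 11 then (n - 23) %/ 12 else
          if n %% 12 == 3 then (n - 15) %/ 12 else (n - 21) %/ 12).
  case: eqP => [?|?]; first by constructor 1; lia.
  case: eqP => [?|?]; first by constructor 2; lia.
  by case: eqP => [?|?]; [constructor 3 | constructor 4]; lia.
case=> p [] ->; [exact: design_12p_5 | exact: design_12p_23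
  | exact: design_12p_15 | exact: design_12p_21].
Qed.

(** * Cycles as components of a 2-regular graph *)

Lemma cycle_nth (T : eqType) (e : rel T) (x : T) (c : seq T) (i : nat) :
    cycle e c -> 0 < size c ->
  e (nth x c (i %% size c)) (nth x c (i.+1 %% size c)).
Proof.
case: c => // y p /(pathP x) adj_p _.
have lt_mod := ltn_pmod i (ltn0Sn (size p)).
have := adj_p (i %% (size p).+1); rewrite size_rcons => /(_ lt_mod).
rewrite -rcons_cons nth_rcons nth_rcons lt_mod.
have /= := lt_mod; rewrite -[i.+1]addn1 -modnDml ltnS leq_eqVlt.
case/predU1P=> [->|lt_p].
  by rewrite ltnn eqxx addn1 modnn.
by rewrite lt_p addn1 [X in _ -> e _ (nth _ _ X)]modn_small.
Qed.

Section Components.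

Variables (V : finType) (G : sgraph V).
Hypothesis G_reg : regular G 2.
Hypothesis G_girth : girth_at_least G 5.

Lemma nbhd_pair x a b : G x a -> G x b -> a != b -> nbhd G x = [set a; b].
Proof.
move=> xa xb neq_ab; apply/esym/eqP; rewrite eqEcard G_reg cards2 neq_ab andbT.
by apply/subsetP => y /set2P[] ->; rewrite inE.
Qed.

Lemma other_neighbour x a : G x a -> exists2 b, G x b & b != a.
Proof.
move=> xa; have : 0 < #|nbhd G x :\ a|.
  by move: (cardsD1 a (nbhd G x)); rewrite G_reg inE xa add1n => -[<-].
by case/card_gt0P => b; rewrite !inE => /andP[neq xb]; exists b.
Qed.

(** Walk on from the end v of a path.  The next vertex cannot be an inner vertex
    of the path, because both neighbours of such a vertex lie on the path before
    v; so it is new, or it is the first vertex x and closes a cycle.  The path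
    is written backwards, from v to x, and m bounds the number of vertices still
    available. *)
Lemma path_closes x m r u v :
    #|V| < size r + m -> uniq (v :: u :: r) -> path G v (u :: r) ->
    last u r = x ->
    (forall z, z \in r -> z != x -> nbhd G z \subset u :: r) ->
  exists2 c, graph_cycle G c & x \in c.
Proof.
elim: m r u v => [|m IHm] r u v lt_m uniq_p path_p last_x inner.
  have le_V : size (v :: u :: r) <= #|V|.
    by rewrite -(card_uniqP uniq_p) max_card.
  by move: (leq_ltn_trans le_V lt_m) => /=; lia.
have G_vu : G v u by case/andP: path_p.
have [z vz neq_zu] := other_neighbour G_vu.
have neq_zv : z != v by apply: contraTneq vz => ->; rewrite adj_irrefl.
have [z_r|z_notr] := boolP (z \in r).
  have [z_x|neq_zx] := eqVneq z x.
    exists (v :: u :: r); last by rewrite -z_x !inE z_r !orbT.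
    rewrite /graph_cycle /ucycleb uniq_p andbT [cycle _ _]rcons_path path_p.
    rewrite [last _ _]last_x -z_x adj_sym vz andbT /= ltnS ltnS.
    by case: (r) z_r.
  have /subsetP/(_ v) := inner z z_r neq_zx.
  rewrite inE adj_sym vz => /(_ isT) v_p.
  by case/andP: uniq_p => /negP.
apply: (IHm (u :: r) v z) => //; first by rewrite [size _]/= addSnnS.
- by rewrite cons_uniq uniq_p andbT !inE !negb_or neq_zv neq_zu.
- by rewrite [path _ _ _]/= adj_sym vz.
move=> y; rewrite inE => /predU1P[->|y_r] neq_yx; last first.
  apply: subset_trans (inner y y_r neq_yx) _.
  by apply/subsetP => t t_p; rewrite inE t_p orbT.
case: r {IHm lt_m inner z_notr} last_x uniq_p path_p
  => [|h r] last_x uniq_p path_p.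
  by rewrite -last_x eqxx in neq_yx.
have G_uh : G u h by case/and3P: path_p.
have neq_vh : v != h.
  by move: uniq_p; rewrite /= !inE !negb_or; case/and3P => /and3P[].
rewrite (nbhd_pair (a := v) (b := h)) //; last by rewrite adj_sym.
by apply/subsetP => t /set2P[] ->; rewrite !inE eqxx ?orbT.
Qed.

Lemma cycle_through x : exists2 c, graph_cycle G c & x \in c.
Proof.
have /card_gt0P[v] : 0 < #|nbhd G x| by rewrite G_reg.
rewrite inE => xv; apply: (@path_closes x #|V|.+1 [::] x v) => //.
- by rewrite /= inE andbT; apply: contraTneq xv => ->; rewrite adj_irrefl.
- by rewrite /= adj_sym xv.
Qed.

(** Indexing a component of length k by all of nat, with period k, avoids
    special cases at the ends.  A vertex is usually named w i.+2, so that the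
    two vertices behind it have an index as well. *)
Definition labelling (k : nat) (w : nat -> V) : Prop :=
  [/\ 4 < k, forall i j, (w i == w j) = (i == j %[mod k])
    & forall i, nbhd G (w i.+1) = [set w i; w i.+2]].

Lemma labelling_through x : exists k w, labelling k w /\ w 2 = x.
Proof.
have [c cyc_c x_c] := cycle_through x.
have c_ge5 : 4 < size c.
  by case: G_girth => g [_ /(_ c cyc_c)] le_g /leq_trans; apply.
have [_ /andP[c_path c_uniq]] := andP cyc_c.
set k := size c in c_ge5 *; pose v i := nth x c (i %% k).
have lt_mod i : i %% k < k by rewrite ltn_mod; lia.
have v_adj i : G (v i) (v i.+1).
  exact: cycle_nth c_path (leq_trans _ c_ge5).
pose a := index x c + k - 2; have le_x : index x c < k by rewrite index_mem.
have w_eq i j : (v (a + i) == v (a + j)) = (i == j %[mod k]).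
  by rewrite /v nth_uniq // eqn_modDl.
exists k, (fun i => v (a + i)); split; first split=> // i.
  rewrite (nbhd_pair (a := v (a + i)) (b := v (a + i.+2))) //.
  - by rewrite adj_sym addnS.
  - by rewrite [a + i.+2]addnS.
  rewrite w_eq -[i]addn0 -!addnS eqn_modDl mod0n.
  by rewrite modn_small // (leq_trans _ c_ge5).
rewrite /v; have -> : a + 2 = index x c + k by rewrite /a; lia.
by rewrite modnDr modn_small // nth_index.
Qed.

Definition close (x y : V) : bool :=
  [|| x == y, G x y | [exists z, G x z && G z y]].

Lemma closeC x y : close x y = close y x.
Proof.
rewrite /close eq_sym adj_sym; congr [|| _, _ | _].
by apply: eq_existsb => z; rewrite andbC [G z y]adj_sym [G x z]adj_sym.
Qed.

Section Labelled.

Variables (k : nat) (w : nat -> V).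
Hypothesis w_lab : labelling k w.

Lemma labelling_adj i y : G (w i.+1) y = (y == w i) || (y == w i.+2).
Proof.
by case: w_lab => _ _ /(_ i)/setP/(_ y); rewrite !inE.
Qed.

Lemma labelling_close i y :
  close (w i.+2) y = (y \in [:: w i; w i.+1; w i.+2; w i.+3; w i.+4]).
Proof.
rewrite !inE /close labelling_adj [w i.+2 == y]eq_sym; apply/idP/idP.
  case/or3P=> [->|/orP[]->|/existsP[z]]; rewrite ?orbT // labelling_adj.
  by case/andP=> /orP[] /eqP->; rewrite labelling_adj => /orP[] ->;
    rewrite ?orbT.
case/or4P=> [/eqP->|->|->|/orP[->|/eqP->]]; rewrite ?orbT //;
  apply/or3P; constructor 3.
  by apply/existsP; exists (w i.+1); rewrite !labelling_adj !eqxx ?orbT.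
by apply/existsP; exists (w i.+3); rewrite !labelling_adj !eqxx ?orbT.
Qed.

Lemma labelling_closeE i a b : close (w (i + (a + 2))) (w (i + b))
  = has (fun j => b == a + j %[mod k]) (iota 0 5).
Proof.
case: w_lab => _ w_eq _; rewrite addnA addn2 labelling_close /= !inE orbF.
by rewrite !addnS !addn0 !w_eq -!addnS !eqn_modDl.
Qed.

Definition component : {set V} := [set w i | i : 'I_k].

Let k_gt0 : 0 < k. Proof. by case: w_lab; lia. Qed.

Lemma in_component i : w i \in component.
Proof.
apply/imsetP; exists (Ordinal (ltn_pmod i k_gt0)) => //=.
by case: w_lab => _ w_eq _; apply/eqP; rewrite w_eq modn_mod.
Qed.

Lemma card_component : #|component| = k.
Proof.
rewrite card_imset ?card_ord // => i j /eqP.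
by case: w_lab => _ -> _; rewrite !modn_small // => /eqP/val_inj.
Qed.

Lemma componentP i y : y \in component -> exists2 r, r < k & y = w (i + r).
Proof.
case/imsetP=> j _ ->; exists ((j + (k - i %% k)) %% k).
  by rewrite ltn_mod.
case: w_lab => _ w_eq _; apply/eqP; rewrite w_eq modnDmr -modnDml.
have lt_i : i %% k < k by rewrite ltn_mod.
have -> : i %% k + (j + (k - i %% k)) = j + k by lia.
by rewrite modnDr.
Qed.

Lemma component_closed x y : G x y -> x \in component -> y \in component.
Proof.
move=> xy /(componentP 1)[r _ x_eq]; move: xy; rewrite x_eq labelling_adj.
by case/orP=> /eqP->; apply: in_component.
Qed.

Lemma component_close x y : close x y -> x \in component -> y \in component.
Proof.
case/or3P=> [/eqP->|xy|/existsP[z /andP[xz zy]] x_c] //.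
  exact: component_closed.
exact: component_closed zy (component_closed xz x_c).
Qed.

End Labelled.

(** If the walk w' ever enters the component of w it stays there, and being
    periodic it comes back to w' i. *)
Lemma component_disjoint k w k' w' i :
    labelling k w -> labelling k' w' -> w' i \notin component k w ->
  [disjoint component k w & component k' w'].
Proof.
move=> lab lab' notin; apply/pred0P => y /=; apply/negP => /andP[y_c].
case/(componentP lab' i) => r _ y_eq; case/negP: notin.
have up j : w' (i + r + j) \in component k w.
  elim: j => [|j IHj]; first by rewrite addn0 -y_eq.
  apply: (component_closed lab _ IHj).
  by rewrite addnS adj_sym (labelling_adj lab') eqxx.
have := up (r * k'.-1); case: lab' => k'_ge5 w_eq _.
suff /eqP -> : w' (i + r + r * k'.-1) == w' i by [].
have -> : i + r + r * k'.-1 = r * k' + i.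
  by case: (k') k'_ge5 => // m _; rewrite /=; lia.
by rewrite w_eq modnMDl.
Qed.

Lemma two_components (k : nat) (w : nat -> V) : labelling k w ->
    component k w != setT ->
  exists k' w', labelling k' w' /\ [disjoint component k w & component k' w'].
Proof.
move=> lab; rewrite -subTset => /subsetPn[y _ y_notin].
have [k' [w' [lab' w'_y]]] := labelling_through y.
exists k', w'; split=> //; apply: (component_disjoint (i := 2) lab lab').
by rewrite w'_y.
Qed.

(** * The orders 9 and 11 *)

Variable B : {set {set V}}.
Hypothesis B_design : is_design G 2 B.

Local Notation N := (closed_nbhd G).

Lemma in_closed_nbhd_close x y z : x \in N z -> y \in N z -> close x y.
Proof.
rewrite !inE /close => /predU1P[->|zx] /predU1P[->|zy]; rewrite ?eqxx //.
- by rewrite zy orbT.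
- by rewrite adj_sym zx orbT.
by apply/or3P; constructor 3; apply/existsP; exists z; rewrite adj_sym zx.
Qed.

Lemma closed_nbhd_neq x y : G x y -> N x != N y.
Proof.
have [k [w [lab <-]]] := labelling_through x.
have [k_ge5 w_eq _] := lab.
have neq i j : i < 5 -> j < 5 -> i != j -> w i != w j.
  by move=> lt_i lt_j; rewrite w_eq !modn_small //; lia.
rewrite (labelling_adj lab) => /orP[] /eqP ->; apply/eqP => /setP.
  move=> /(_ (w 3)); rewrite !inE (labelling_adj lab) eqxx !orbT.
  by rewrite (negPf (neq 3 1 _ _ _)) // (labelling_adj lab)
     (negPf (neq 3 0 _ _ _)) // (negPf (neq 3 2 _ _ _)).
move=> /(_ (w 1)); rewrite !inE (labelling_adj lab) eqxx !orbT.
by rewrite (negPf (neq 1 3 _ _ _)) // (labelling_adj lab)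
     (negPf (neq 1 2 _ _ _)) // (negPf (neq 1 4 _ _ _)).
Qed.

(** The closed neighbourhoods exhaust the blocks through a pair of adjacent
    vertices, or of vertices with a common neighbour. *)
Lemma close_block b x y : b \in B -> x \in b -> y \in b -> x != y ->
  close x y -> exists z, b = N z.
Proof.
case: B_design => _ _ one two N_B bB xb yb neq_xy.
rewrite /close (negPf neq_xy) /=; case Gxy: (G x y) => /=.
  move=> _; have b_in : b \in [set b in B | (x \in b) && (y \in b)].
    by rewrite inE bB xb.
  suff E : [set N x; N y] = [set b in B | (x \in b) && (y \in b)].
    by move: b_in; rewrite -E => /set2P[] ->; [exists x | exists y].
  apply/eqP; rewrite eqEcard two // cards2 (closed_nbhd_neq Gxy) andbT.
  apply/subsetP => c /set2P[] ->.
    by rewrite !inE N_B eqxx Gxy !orbT.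
  by rewrite !inE N_B eqxx [G y x]adj_sym Gxy !orbT.
case/existsP=> z /andP[xz zy]; exists z.
have /eqP/cards1P[c c_eq] := one x y neq_xy (negbT Gxy).
have : b \in [set c] by rewrite -c_eq inE bB xb.
have : N z \in [set c] by rewrite -c_eq !inE N_B [G z x]adj_sym xz zy !orbT.
by move=> /set1P -> /set1P.
Qed.

(** These are the blocks that are not closed neighbourhoods. *)
Definition far_triple x y z : Prop :=
  [/\ ~~ close x y, ~~ close x z, ~~ close y z
    & exists2 b, b \in B & [&& x \in b, y \in b & z \in b]].

Lemma far_triple_exists x y : ~~ close x y -> exists z, far_triple x y z.
Proof.
move=> nclose; have [sz _ one _ _] := B_design.
have neq_xy : x != y by apply: contraNneq nclose => ->; rewrite /close eqxx.
have nadj : ~~ G x y by apply: contraNN nclose => xy; rewrite /close xy orbT.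
have /eqP/cards1P[b b_eq] := one x y neq_xy nadj.
have : b \in [set b] by rewrite set11.
rewrite -b_eq inE => /and3P[bB xb yb].
have notN z : b <> N z.
  move=> bN; case/negP: nclose.
  by apply: (@in_closed_nbhd_close _ _ z); rewrite -bN.
have : 0 < #|b :\: [set x; y]|.
  have : #|b :&: [set x; y]| <= #|[set x; y]|.
    by apply: subset_leq_card; apply: subsetIr.
  by rewrite cardsD (sz b bB) cards2; case: (_ != _); lia.
case/card_gt0P=> z; rewrite !inE negb_or => /andP[/andP[zx zy] zb].
exists z; split=> //; last by exists b; rewrite // xb yb.
- by apply/negP => /(close_block bB xb zb); rewrite eq_sym => /(_ zx)[t /notN].
- by apply/negP => /(close_block bB yb zb); rewrite eq_sym => /(_ zy)[t /notN].
Qed.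

Lemma far_triple_rot x y z : far_triple x y z -> far_triple y z x.
Proof.
case=> xy xz yz [b bB /and3P[xb yb zb]].
by split; rewrite // 1?closeC //; exists b; rewrite // yb zb xb.
Qed.

Lemma close_refl x : close x x. Proof. by rewrite /close eqxx. Qed.

Lemma far_triple_unique x y z z' :
  far_triple x y z -> far_triple x y z' -> z = z'.
Proof.
move=> [xy xz yz [b bB /and3P[xb yb zb]]].
move=> [_ xz' yz' [b' b'B /and3P[xb' yb' zb']]].
have [sz _ one _ _] := B_design.
have neq (u v : V) : ~~ close u v -> u != v.
  by apply: contraNneq => ->; rewrite close_refl.
have nadj : ~~ G x y by apply: contraNN xy => Gxy; rewrite /close Gxy orbT.
have /eqP/cards1P[c c_eq] := one x y (neq _ _ xy) nadj.
have /set1P E : b \in [set c] by rewrite -c_eq inE bB xb.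
have /set1P E' : b' \in [set c] by rewrite -c_eq inE b'B xb'.
rewrite {}E' -{}E in zb'; apply/eqP; apply/negPn/negP => neq_z.
have uniq4 : uniq [:: x; y; z; z'].
  rewrite /= !inE !negb_or (neq _ _ xy) (neq _ _ xz) (neq _ _ xz').
  by rewrite (neq _ _ yz) (neq _ _ yz') neq_z.
have : #|[:: x; y; z; z']| <= #|b|.
  by apply: subset_leq_card; apply/subsetP => u; rewrite !inE => /or4P[] /eqP->.
by rewrite (card_uniqP uniq4) (sz b bB).
Qed.

(** The vertices near 2 or near 6, namely 0, ..., 4 and 4, ..., 8, are all
    vertices. *)
Lemma no_component_9 w : labelling 9 w -> component 9 w != setT.
Proof.
move=> lab; apply/eqP => allV.
have far_w : ~~ close (w 2) (w 6) by rewrite (labelling_closeE lab 0 0 6).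
have [z [_ nz2 nz6 _]] := far_triple_exists far_w.
have /(componentP lab 0)[r lt_r z_eq] : z \in component 9 w.
  by rewrite allV inE.
move: nz2 nz6.
rewrite z_eq (labelling_closeE lab 0 0 r) (labelling_closeE lab 0 4 r).
by case: r lt_r {z_eq} => [|[|[|[|[|[|[|[|[|r]]]]]]]]].
Qed.

(** The third point of a block is far from the other two, and this leaves one
    possibility for the pair {2, 7}, namely 10, and two for {2, 6}, namely 9 and
    10.  The latter is excluded because {2, 10} is in a block with 7. *)
Lemma no_component_11 w : labelling 11 w -> component 11 w != setT.
Proof.
move=> lab; apply/eqP => allV; have [_ w_eq _] := lab.
have third i t : 2 < t < 9 -> exists r,
    [/\ r < 11, ~~ has (fun j => r == j %[mod 11]) (iota 0 5),
        ~~ has (fun j => r == t + j %[mod 11]) (iota 0 5)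
      & far_triple (w (i + 2)) (w (i + (t + 2))) (w (i + r))].
  move=> t_in; have far_w : ~~ close (w (i + 2)) (w (i + (t + 2))).
    rewrite (labelling_closeE lab i 0).
    by case: t t_in => [|[|[|[|[|[|[|[|[|t]]]]]]]]].
  have [z z_far] := far_triple_exists far_w; have [_ nz2 nzt _] := z_far.
  have /(componentP lab i)[r lt_r z_eq] : z \in component 11 w.
    by rewrite allV inE.
  exists r; rewrite -z_eq; split=> //.
    by rewrite -(labelling_closeE lab i 0) -z_eq.
  by rewrite -(labelling_closeE lab i t) -z_eq.
have block_5_8 i : far_triple (w (i + 2)) (w (i + 7)) (w (i + 10)).
  have [r [lt_r]] := third i 5 isT.
  by case: r lt_r => [|[|[|[|[|[|[|[|[|[|[|r]]]]]]]]]]].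
have block_4_7 i : far_triple (w (i + 2)) (w (i + 6)) (w (i + 9)).
  have [r [lt_r]] := third i 4 isT.
  case: r lt_r => [|[|[|[|[|[|[|[|[|[|[|r]]]]]]]]]]] // _ _ _ T.
  have T' := far_triple_rot (far_triple_rot (block_5_8 i)).
  have /eqP := far_triple_unique (far_triple_rot (far_triple_rot T)) T'.
  by rewrite w_eq eqn_modDl.
(* The pair {2, 9} lies in the blocks {2, 6, 9} and {9, 13, 16} = {9, 2, 5}. *)
have T := far_triple_rot (far_triple_rot (block_4_7 0)).
have := block_4_7 7; have /eqP -> : w (7 + 6) == w 2 by rewrite w_eq.
by move=> /(far_triple_unique T)/eqP; rewrite w_eq.
Qed.

(** Let y be outside the 5-cycle R.  For two vertices x of R, the third point of
    the block through x and y is far from x, hence outside R, and far from y;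
    with at most 11 vertices this determines it, so the pair that it forms with
    y lies in two blocks. *)
Lemma no_component_5 w : labelling 5 w -> 5 < #|V| -> 11 < #|V|.
Proof.
move=> lab lt_V; rewrite ltnNge; apply/negP => le_V.
have [_ w_eq _] := lab.
have R5 := card_component lab; set R := component 5 w in R5.
have /subsetPn[y _ yR] : ~~ ([set: V] \subset R).
  by apply/negP => /subset_leq_card; rewrite cardsT R5; lia.
have wR i : w i \in R by apply: in_component.
have far_R x z : x \in R -> z \notin R -> ~~ close x z.
  by move=> xR; apply: contraNN => /(component_close lab)/(_ xR).
have close_R i z : z \in R -> close (w i.+2) z.
  move=> /(componentP lab i)[r lt_r ->]; rewrite (labelling_close lab) !inE.
  by case: r lt_r => [|[|[|[|[|r]]]]] // _; rewrite ?addnS ?addn0 eqxx ?orbT.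
have [k' [w' [lab' w'_y]]] := labelling_through y.
pose S := ~: (R :|: [set z | close y z]).
have S_le1 : #|S| <= 1.
  have ball5 : #|[set z | close y z]| = 5.
    have -> : [set z | close y z]
        = [set z in [:: w' 0; w' 1; w' 2; w' 3; w' 4]].
      by apply/setP => z; rewrite !inE -w'_y (labelling_close lab') !inE.
    rewrite cardsE; apply/card_uniqP; rewrite /= !inE.
    by case: lab' => k'_ge5 w'_eq _; rewrite !w'_eq !modn_small //; lia.
  have disj : R :&: [set z | close y z] = set0.
    apply/setP => z; rewrite !inE; apply/negP => /andP[zR yz].
    by case/negP: (far_R z y zR yR); rewrite closeC.
  rewrite cardsCs setCK cardsU disj cards0 R5 ball5; lia.
have third i : exists2 z, z \in S & far_triple (w i.+2) y z.
  have [z z_far] := far_triple_exists (far_R _ _ (wR i.+2) yR).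
  exists z => //; case: z_far => _ nz yz _; rewrite !inE negb_or yz andbT.
  by apply: contraNN nz; apply: close_R.
have [z zS tz] := third 0; have [z' z'S tz'] := third 1.
have z_eq : z' = z.
  by have /card_le1P/(_ z zS z') := S_le1; rewrite z'S inE => /esym/eqP.
rewrite {}z_eq in tz'.
have := far_triple_unique (far_triple_rot tz) (far_triple_rot tz').
by move/eqP; rewrite w_eq.
Qed.

Lemma no_design_9_11 : #|V| = 9 \/ #|V| = 11 -> False.
Proof.
move=> cardV; have /card_gt0P[x _] : 0 < #|V| by lia.
have [k [w [lab _]]] := labelling_through x.
have k_ge5 : 4 < k by case: lab.
have [allV|] := eqVneq (component k w) setT.
  have k_eq : k = #|V| by rewrite -(card_component lab) allV cardsT.
  case: cardV => cardV; rewrite cardV in k_eq; subst k.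
    by have /eqP := no_component_9 lab.
  by have /eqP := no_component_11 lab.
case/(two_components lab) => k' [w' [lab' disj]].
have k'_ge5 : 4 < k' by case: lab'.
have le_V : k + k' <= #|V|.
  rewrite -(card_component lab) -(card_component lab') -cardsUI.
  by rewrite (eqP (_ : _ :&: _ == set0)) ?setI_eq0 // cards0 addn0 max_card.
have [k_eq|k'_eq] : k = 5 \/ k' = 5 by lia.
  by subst k; have := no_component_5 lab; lia.
by subst k'; have := no_component_5 lab'; lia.
Qed.

End Components.

Theorem theorem4p3 (n : nat) (hn : 5 <= n)
    (hmod : n = 3 %[mod 6] \/ n = 5 %[mod 6]) :
  (~ (n = 9 \/ n = 11) ->
     exists (V : finType) (G : sgraph V),
       [/\ #|V| = n, regular G 2, girth_at_least G 5
         & exists B : {set {set V}}, is_design G 2 B]) /\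
  (n = 9 \/ n = 11 ->
     ~ exists (V : finType) (G : sgraph V),
       [/\ #|V| = n, regular G 2, girth_at_least G 5
         & exists B : {set {set V}}, is_design G 2 B]).
Proof.
split; first exact: design_of_order_exists.
move=> n_9_11 [V [G [cardV G_reg G_girth [B B_design]]]].
by apply: (no_design_9_11 G_reg G_girth B_design); rewrite cardV.
Qed.
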